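(* Let $\mathcal{E}$ be a locally Cartesian closed category with a probability monad $\mathcal{P}:\mathcal{E}\to\mathcal{E}$, let $\mathbb{T}$ be a monoid in $\mathcal{E}$, let $(\theta,\beta)$ be a closed measure-preserving dynamical system in $\mathcal{E}$ with time $\mathbb{T}$ and state space $\Omega$, and let $p$ be a polynomial in $\mathcal{E}$. Open random dynamical systems over $(\theta,\beta)$ on the interface $p$ form the objects of a category $\mathbf{RDyn}^{\mathbb{T}}(p,\theta)$, in which a morphism $f:(\pi_X:X\to\Omega,\vartheta^o,\vartheta^u)\to(\pi_Y:Y\to\Omega,\psi^o,\psi^u)$ is a map $f:X\to Y$ in $\mathcal{E}$ such that $\pi_Y\circ f=\pi_X$ and, for all times $t:\mathbb{T}$ and sections $\sigma$ of $p$, $$ f\circ\vartheta^u(t)\circ\vartheta^o(t)^*\sigma=\psi^u(t)\circ\psi^o(t)^*\sigma\circ f ,$$ with identities the identity maps on state spaces and composition that of $\mathcal{E}$.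
   Context: $\mathcal{E}$ is thought of as concrete (e.g. $\mathbf{Set}$ with the finitely-supported distribution monad), and element notation is used; $1$ is its terminal object. A polynomial in $\mathcal{E}$ is $p=\sum_{i:p(1)}y^{p[i]}$ with $y^A=\mathcal{E}(A,-)$, equivalently a bundle $\sum_{i:p(1)}p[i]\to p(1)$ with fibres $p[i]$; a section of $p$ is a section $\sigma:p(1)\to\sum_ip[i]$ of this bundle. A probability monad is a monad $\mathcal{P}$ on $\mathcal{E}$, thought of as sending a space to the space of probability distributions on it. A probability space $(B,\beta)$ is an object of $1/\mathcal{K}\ell(\mathcal{P})$, i.e. $B:\mathcal{E}$ with $\beta:1\to\mathcal{P}B$. A closed dynamical system on $\Omega$ with time $\mathbb{T}$ is an action of $\mathbb{T}$ on $\Omega$ (equivalently a functor $\mathbf{B}\mathbb{T}\to\mathcal{E}$ from the one-object category of $\mathbb{T}$, with value $\Omega$). It is measure-preserving with respect to $\beta:1\to\mathcal{P}\Omega$ if $\mathcal{P}\theta(t)\circ\beta=\beta$ for all $t:\mathbb{T}$; the pair $(\theta,\beta)$ is then called a closed measure-preserving dynamical system. An open random dynamical system over $(\theta,\beta)$ on the interface $p$ with state space $\pi:S\to\Omega$ (a morphism of $\mathcal{E}$) and time $\mathbb{T}$ is a triple $(\pi,\vartheta^o,\vartheta^u)$ with $\vartheta^o:\mathbb{T}\times S\to p(1)$ and $\vartheta^u:\sum_{t:\mathbb{T}}\sum_{s:S}p[\vartheta^o(t,s)]\to S$ such that, for every section $\sigma$ of $p$, the maps $\vartheta^\sigma(t):=\vartheta^u(t)\circ\vartheta^o(t)^*\sigma:S\to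 S$ form (with $\pi$) an object of the slice $\mathbf{Cat}(\mathbf{B}\mathbb{T},\mathcal{E})/\theta$, so that $\vartheta^\sigma$ is a closed dynamical system on $S$ and $\pi\circ\vartheta^\sigma(t)=\theta(t)\circ\pi$ for all $t$. Here $\vartheta^o(t)^*\sigma:S\to\sum_{s:S}p[\vartheta^o(t,s)]$ is $s\mapsto(s,\sigma(\vartheta^o(t,s)))$. *)

(* Defs.v *)
From Stdlib Require Import ProofIrrelevance.

Set Implicit Arguments.
Unset Strict Implicit.
Unset Printing Implicit Defensive.

Declare Scope cat_scope.
Delimit Scope cat_scope with cat.
Local Open Scope cat_scope.

Record category_on (Ob : Type) (Hom : Ob -> Ob -> Type) : Type := CategoryOn {
  id_of : forall X, Hom X X;
  comp_of : forall X Y Z, Hom Y Z -> Hom X Y -> Hom X Z;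
  comp_of_idl : forall X Y (f : Hom X Y), comp_of (id_of Y) f = f;
  comp_of_idr : forall X Y (f : Hom X Y), comp_of f (id_of X) = f;
  comp_of_assoc : forall W X Y Z (h : Hom Y Z) (g : Hom X Y) (f : Hom W X),
    comp_of h (comp_of g f) = comp_of (comp_of h g) f
}.

Record category : Type := Category {
  ob :> Type;
  hom : ob -> ob -> Type;
  cat_struct : category_on hom
}.
Arguments hom {c} _ _.

Definition idm {C : category} (X : C) : hom X X := id_of (cat_struct C) X.
Definition comp {C : category} {X Y Z : C} (g : hom Y Z) (f : hom X Y) : hom X Z :=
  comp_of (cat_struct C) g f.

Notation "g ∘ f" := (comp g f) (at level 40, left associativity) : cat_scope.

Lemma comp_idl (C : category) (X Y : C) (f : hom X Y) : idm Y ∘ f = f.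
Proof. apply comp_of_idl. Qed.

Lemma comp_idr (C : category) (X Y : C) (f : hom X Y) : f ∘ idm X = f.
Proof. apply comp_of_idr. Qed.

Lemma comp_assoc (C : category) (W X Y Z : C)
  (h : hom Y Z) (g : hom X Y) (f : hom W X) : h ∘ (g ∘ f) = h ∘ g ∘ f.
Proof. apply comp_of_assoc. Qed.

Record terminal_object (C : category) : Type := TerminalObject {
  term_ob : C;
  term_map : forall X : C, hom X term_ob;
  term_uniq : forall (X : C) (f : hom X term_ob), f = term_map X
}.

Record binary_products (C : category) : Type := BinaryProducts {
  bp_ob : C -> C -> C;
  bp_fst : forall A B, hom (bp_ob A B) A;
  bp_snd : forall A B, hom (bp_ob A B) B;
  bp_pair : forall X A B, hom X A -> hom X B -> hom X (bp_ob A B);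
  bp_pair_fst : forall X A B (f : hom X A) (g : hom X B),
    bp_fst A B ∘ bp_pair f g = f;
  bp_pair_snd : forall X A B (f : hom X A) (g : hom X B),
    bp_snd A B ∘ bp_pair f g = g;
  bp_pair_uniq : forall X A B (h : hom X (bp_ob A B)),
    h = bp_pair (bp_fst A B ∘ h) (bp_snd A B ∘ h)
}.
Arguments bp_fst {C} b A B.
Arguments bp_snd {C} b A B.
Arguments bp_pair {C} b {X A B} _ _.

Definition bp_map (C : category) (P : binary_products C) (A B A' B' : C)
  (f : hom A A') (g : hom B B') : hom (bp_ob P A B) (bp_ob P A' B') :=
  bp_pair P (f ∘ bp_fst P A B) (g ∘ bp_snd P A B).

Record exponentials (C : category) (P : binary_products C) : Type := Exponentials {
  exp_ob : C -> C -> C;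
  exp_eval : forall A B, hom (bp_ob P (exp_ob A B) A) B;
  exp_curry : forall X A B, hom (bp_ob P X A) B -> hom X (exp_ob A B);
  exp_curry_eval : forall X A B (f : hom (bp_ob P X A) B),
    exp_eval A B ∘ bp_map P (exp_curry f) (idm A) = f;
  exp_curry_uniq : forall X A B (g : hom X (exp_ob A B)),
    g = exp_curry (exp_eval A B ∘ bp_map P g (idm A))
}.

Record cartesian_closed (C : category) : Type := CartesianClosed {
  cc_term : terminal_object C;
  cc_prod : binary_products C;
  cc_exp : exponentials cc_prod
}.

Record slice_ob (C : category) (B : C) : Type := SliceOb {
  slice_dom : C;
  slice_arr : hom slice_dom B
}.
Arguments SliceOb {C B slice_dom} _.

Record slice_hom (C : category) (B : C) (X Y : slice_ob B) : Type := SliceHom {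
  slice_map : hom (slice_dom X) (slice_dom Y);
  slice_tri : slice_arr Y ∘ slice_map = slice_arr X
}.
Arguments SliceHom {C B X Y} _ _.

Lemma slice_hom_eq (C : category) (B : C) (X Y : slice_ob B)
  (f g : slice_hom X Y) : slice_map f = slice_map g -> f = g.
Proof.
destruct f as [f Hf], g as [g Hg]; simpl; intros ->.
f_equal; apply proof_irrelevance.
Qed.

Definition slice_id (C : category) (B : C) (X : slice_ob B) : slice_hom X X :=
  SliceHom (idm (slice_dom X)) (comp_idr (slice_arr X)).

Lemma slice_comp_tri (C : category) (B : C) (X Y Z : slice_ob B)
  (g : slice_hom Y Z) (f : slice_hom X Y) :
  slice_arr Z ∘ (slice_map g ∘ slice_map f) = slice_arr X.
Proof. rewrite comp_assoc, slice_tri; apply slice_tri. Qed.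

Definition slice_comp (C : category) (B : C) (X Y Z : slice_ob B)
  (g : slice_hom Y Z) (f : slice_hom X Y) : slice_hom X Z :=
  SliceHom (slice_map g ∘ slice_map f) (slice_comp_tri g f).

Definition slice_struct (C : category) (B : C) : category_on (@slice_hom C B).
Proof.
refine (CategoryOn (id_of := @slice_id C B) (comp_of := @slice_comp C B) _ _ _);
  intros; apply slice_hom_eq; simpl.
- apply comp_idl.
- apply comp_idr.
- apply comp_assoc.
Defined.

Definition slice (C : category) (B : C) : category := Category (slice_struct B).

Record lcc (E : category) : Type := LCC {
  lcc_term : terminal_object E;
  lcc_slice : forall B : E, cartesian_closed (slice B)
}.

Section FiniteLimits.
Variables (E : category) (L : lcc E).

Definition one : E := term_ob (lcc_term L).
Definition bang (X : E) : hom X one := term_map (lcc_term L) X.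

(** Pullbacks over [B] are the binary products of the slice over [B], and the
    products of [E] are the pullbacks over the terminal object. *)
Section Pullback.
Variables (X Y B : E) (f : hom X B) (g : hom Y B).

Let P : slice_ob B := @bp_ob (slice B) (cc_prod (lcc_slice L B)) (SliceOb f) (SliceOb g).

Definition pb : E := slice_dom P.
Definition pb_fst : hom pb X :=
  slice_map (@bp_fst (slice B) (cc_prod (lcc_slice L B)) (SliceOb f) (SliceOb g)).
Definition pb_snd : hom pb Y :=
  slice_map (@bp_snd (slice B) (cc_prod (lcc_slice L B)) (SliceOb f) (SliceOb g)).

Definition pb_pair (Z : E) (a : hom Z X) (b : hom Z Y) (e : f ∘ a = g ∘ b) : hom Z pb :=
  slice_map (@bp_pair (slice B) (cc_prod (lcc_slice L B))
    (SliceOb (f ∘ a)) (SliceOb f) (SliceOb g)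
    (@SliceHom E B (SliceOb (f ∘ a)) (SliceOb f) a eq_refl)
    (@SliceHom E B (SliceOb (f ∘ a)) (SliceOb g) b (eq_sym e))).

Lemma pb_square : f ∘ pb_fst = g ∘ pb_snd.
Proof.
exact (eq_trans
  (slice_tri (@bp_fst (slice B) (cc_prod (lcc_slice L B)) (SliceOb f) (SliceOb g)))
  (eq_sym
    (slice_tri (@bp_snd (slice B) (cc_prod (lcc_slice L B)) (SliceOb f) (SliceOb g))))).
Qed.

Lemma pb_pair_fst (Z : E) (a : hom Z X) (b : hom Z Y) (e : f ∘ a = g ∘ b) :
  pb_fst ∘ pb_pair e = a.
Proof.
exact (f_equal (@slice_map _ _ _ _)
  (@bp_pair_fst (slice B) (cc_prod (lcc_slice L B))
    (SliceOb (f ∘ a)) (SliceOb f) (SliceOb g)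
    (@SliceHom E B (SliceOb (f ∘ a)) (SliceOb f) a eq_refl)
    (@SliceHom E B (SliceOb (f ∘ a)) (SliceOb g) b (eq_sym e)))).
Qed.

Lemma pb_pair_snd (Z : E) (a : hom Z X) (b : hom Z Y) (e : f ∘ a = g ∘ b) :
  pb_snd ∘ pb_pair e = b.
Proof.
exact (f_equal (@slice_map _ _ _ _)
  (@bp_pair_snd (slice B) (cc_prod (lcc_slice L B))
    (SliceOb (f ∘ a)) (SliceOb f) (SliceOb g)
    (@SliceHom E B (SliceOb (f ∘ a)) (SliceOb f) a eq_refl)
    (@SliceHom E B (SliceOb (f ∘ a)) (SliceOb g) b (eq_sym e)))).
Qed.

Lemma pb_eq (Z : E) (h k : hom Z pb) :
  pb_fst ∘ h = pb_fst ∘ k -> pb_snd ∘ h = pb_snd ∘ k -> h = k.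
Proof.
intros H1 H2.
assert (HP : f ∘ pb_fst = slice_arr P).
{ exact (slice_tri
    (@bp_fst (slice B) (cc_prod (lcc_slice L B)) (SliceOb f) (SliceOb g))). }
assert (Hh : slice_arr P ∘ h = f ∘ pb_fst ∘ h) by (rewrite HP; reflexivity).
assert (Hk : slice_arr P ∘ k = f ∘ pb_fst ∘ h).
{ rewrite <- HP, <- !comp_assoc, H1; reflexivity. }
pose (h' := @SliceHom E B (SliceOb (f ∘ pb_fst ∘ h)) P h Hh).
pose (k' := @SliceHom E B (SliceOb (f ∘ pb_fst ∘ h)) P k Hk).
enough (h' = k') as Hhk by exact (f_equal (@slice_map _ _ _ _) Hhk).
rewrite (@bp_pair_uniq (slice B) (cc_prod (lcc_slice L B))
  (SliceOb (f ∘ pb_fst ∘ h)) (SliceOb f) (SliceOb g) h').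
rewrite (@bp_pair_uniq (slice B) (cc_prod (lcc_slice L B))
  (SliceOb (f ∘ pb_fst ∘ h)) (SliceOb f) (SliceOb g) k').
f_equal; apply slice_hom_eq; assumption.
Qed.

End Pullback.

Definition cprod (X Y : E) : E := pb (bang X) (bang Y).
Definition pr1 (X Y : E) : hom (cprod X Y) X := pb_fst (bang X) (bang Y).
Definition pr2 (X Y : E) : hom (cprod X Y) Y := pb_snd (bang X) (bang Y).

Lemma to_one_eq (Z : E) (f g : hom Z one) : f = g.
Proof. transitivity (bang Z); [ | symmetry]; apply term_uniq. Qed.

Definition cpair (Z X Y : E) (a : hom Z X) (b : hom Z Y) : hom Z (cprod X Y) :=
  pb_pair (to_one_eq (bang X ∘ a) (bang Y ∘ b)).

Definition cprod_map (X Y X' Y' : E) (f : hom X X') (g : hom Y Y') :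
  hom (cprod X Y) (cprod X' Y') :=
  cpair (f ∘ pr1 X Y) (g ∘ pr2 X Y).

Definition cprod_assoc (X Y Z : E) : hom (cprod (cprod X Y) Z) (cprod X (cprod Y Z)) :=
  cpair (pr1 X Y ∘ pr1 (cprod X Y) Z)
       (cpair (pr2 X Y ∘ pr1 (cprod X Y) Z) (pr2 (cprod X Y) Z)).

Lemma cpair_fst (Z X Y : E) (a : hom Z X) (b : hom Z Y) : pr1 X Y ∘ cpair a b = a.
Proof. apply pb_pair_fst. Qed.

Lemma cpair_snd (Z X Y : E) (a : hom Z X) (b : hom Z Y) : pr2 X Y ∘ cpair a b = b.
Proof. apply pb_pair_snd. Qed.

Lemma cprod_eq (Z X Y : E) (h k : hom Z (cprod X Y)) :
  pr1 X Y ∘ h = pr1 X Y ∘ k -> pr2 X Y ∘ h = pr2 X Y ∘ k -> h = k.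
Proof. apply pb_eq. Qed.

End FiniteLimits.

Arguments bang {E} L X.
Arguments pb {E} L {X Y B} f g.
Arguments pb_fst {E} L {X Y B} f g.
Arguments pb_snd {E} L {X Y B} f g.
Arguments pb_pair {E} L {X Y B f g Z a b} e.
Arguments cprod {E} L X Y.
Arguments pr1 {E} L X Y.
Arguments pr2 {E} L X Y.
Arguments cpair {E} L {Z X Y} a b.
Arguments cprod_map {E} L {X Y X' Y'} f g.
Arguments cprod_assoc {E} L X Y Z.

Record monad (E : category) : Type := Monad {
  mon_ob :> E -> E;
  mon_map : forall X Y : E, hom X Y -> hom (mon_ob X) (mon_ob Y);
  mon_unit : forall X : E, hom X (mon_ob X);
  mon_mult : forall X : E, hom (mon_ob (mon_ob X)) (mon_ob X);
  mon_map_id : forall X : E, mon_map (idm X) = idm (mon_ob X);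
  mon_map_comp : forall (X Y Z : E) (g : hom Y Z) (f : hom X Y),
    mon_map (g ∘ f) = mon_map g ∘ mon_map f;
  mon_unit_nat : forall (X Y : E) (f : hom X Y),
    mon_unit Y ∘ f = mon_map f ∘ mon_unit X;
  mon_mult_nat : forall (X Y : E) (f : hom X Y),
    mon_mult Y ∘ mon_map (mon_map f) = mon_map f ∘ mon_mult X;
  mon_unitl : forall X : E, mon_mult X ∘ mon_unit (mon_ob X) = idm (mon_ob X);
  mon_unitr : forall X : E, mon_mult X ∘ mon_map (mon_unit X) = idm (mon_ob X);
  mon_assoc : forall X : E,
    mon_mult X ∘ mon_map (mon_mult X) = mon_mult X ∘ mon_mult (mon_ob X)
}.
Arguments mon_map {E} m {X Y} f.

Record monoid (E : category) (L : lcc E) : Type := Monoid {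
  mnd_ob :> E;
  mnd_one : hom (one L) mnd_ob;
  mnd_mul : hom (cprod L mnd_ob mnd_ob) mnd_ob;
  mnd_mul1l : mnd_mul ∘ cprod_map L mnd_one (idm mnd_ob) = pr2 L (one L) mnd_ob;
  mnd_mul1r : mnd_mul ∘ cprod_map L (idm mnd_ob) mnd_one = pr1 L mnd_ob (one L);
  mnd_mulA : mnd_mul ∘ cprod_map L mnd_mul (idm mnd_ob) =
    mnd_mul ∘ cprod_map L (idm mnd_ob) mnd_mul ∘ cprod_assoc L mnd_ob mnd_ob mnd_ob
}.

(** [p(1)], [sum_i p[i]] and the bundle between them, whose fibres are the
    [p[i]]. *)
Record polynomial (E : category) : Type := Polynomial {
  poly_pos : E;
  poly_tot : E;
  poly_bundle : hom poly_tot poly_pos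
}.

Record section (E : category) (p : polynomial E) : Type := SectionOf {
  sec_map :> hom (poly_pos p) (poly_tot p);
  sec_eq : poly_bundle p ∘ sec_map = idm (poly_pos p)
}.

Section Dynamics.
Variables (E : category) (L : lcc E) (T : monoid L).

Definition is_action (S : E) (a : hom (cprod L T S) S) : Prop :=
  a ∘ cprod_map L (mnd_one T) (idm S) = pr2 L (one L) S /\
  a ∘ cprod_map L (mnd_mul T) (idm S) =
    a ∘ cprod_map L (idm (mnd_ob T)) a ∘ cprod_assoc L T T S.

Record dynsys (S : E) : Type := DynSys {
  dyn_act : hom (cprod L T S) S;
  dyn_actP : is_action dyn_act
}.

(** Elements [t : T] are read as generalized elements [t : I -> T] at an
    arbitrary stage [I]; a map "[S -> S] depending on [t]" is then a map
    [I * S -> S]. *)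
Definition dyn_at (S : E) (th : dynsys S) (I : E) (t : hom I T) : hom (cprod L I S) S :=
  dyn_act th ∘ cprod_map L t (idm S).

(** [theta(t) : S -> S] for a global element [t]. *)
Definition dyn_pt (S : E) (th : dynsys S) (t : hom (one L) T) : hom S S :=
  dyn_act th ∘ cpair L (t ∘ bang L S) (idm S).

(** [P] carries no strength, so [P (theta t)] is only meaningful for global [t]. *)
Definition measure_preserving (P : monad E) (S : E) (th : dynsys S)
  (b : hom (one L) (P S)) : Prop :=
  forall t : hom (one L) T, mon_map P (dyn_pt th t) ∘ b = b.

Record mpds (P : monad E) : Type := MPDS {
  mp_state : E;
  mp_dyn : dynsys mp_state;
  mp_meas : hom (one L) (P mp_state);
  mp_pres : measure_preserving mp_dyn mp_meas
}.

Section Open.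
Variable p : polynomial E.

(** [sum_{z:Z} p[o z]] *)
Definition fib_sum (Z : E) (o : hom Z (poly_pos p)) : E := pb L o (poly_bundle p).

Lemma fib_sum_reindex_eq (Z W : E) (o : hom Z (poly_pos p)) (k : hom W Z) :
  o ∘ (k ∘ pb_fst L (o ∘ k) (poly_bundle p)) =
  poly_bundle p ∘ pb_snd L (o ∘ k) (poly_bundle p).
Proof. rewrite comp_assoc; apply pb_square. Qed.

(** [(w, x) |-> (k w, x)] *)
Definition fib_sum_reindex (Z W : E) (o : hom Z (poly_pos p)) (k : hom W Z) :
  hom (fib_sum (o ∘ k)) (fib_sum o) :=
  pb_pair L (fib_sum_reindex_eq o k).

Lemma sec_pull_eq (Z : E) (o : hom Z (poly_pos p)) (s : section p) :
  o ∘ idm Z = poly_bundle p ∘ (s ∘ o).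
Proof. rewrite comp_assoc, sec_eq, comp_idl; apply comp_idr. Qed.

(** [o^* s : z |-> (z, s (o z))] *)
Definition sec_pull (Z : E) (o : hom Z (poly_pos p)) (s : section p) :
  hom Z (fib_sum o) :=
  pb_pair L (sec_pull_eq o s).

Section Loop.
Variables (S : E) (o : hom (cprod L T S) (poly_pos p)) (u : hom (fib_sum o) S).

Definition out_at (I : E) (t : hom I T) : hom (cprod L I S) (poly_pos p) :=
  o ∘ cprod_map L t (idm S).

Definition upd_at (I : E) (t : hom I T) : hom (fib_sum (out_at t)) S :=
  u ∘ fib_sum_reindex o (cprod_map L t (idm S)).

Definition loop_at (s : section p) (I : E) (t : hom I T) : hom (cprod L I S) S :=
  upd_at t ∘ sec_pull (out_at t) s.

(** The whole family [t |-> loop_at s t], as one map [T * S -> S]. *)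
Definition loop (s : section p) : hom (cprod L T S) S := u ∘ sec_pull o s.

Lemma loop_atE (s : section p) (I : E) (t : hom I T) :
  loop_at s t = loop s ∘ cprod_map L t (idm S).
Proof.
unfold loop_at, upd_at, loop; rewrite <- !comp_assoc; f_equal.
unfold fib_sum_reindex, sec_pull, fib_sum; apply pb_eq; rewrite !comp_assoc.
- rewrite !pb_pair_fst, <- comp_assoc, pb_pair_fst, comp_idr, comp_idl; reflexivity.
- rewrite !pb_pair_snd; unfold out_at; rewrite <- !comp_assoc; reflexivity.
Qed.

End Loop.

Section Random.
Variables (P : monad E) (M : mpds P).

Record open_rds : Type := OpenRDS {
  rds_state : E;
  rds_proj : hom rds_state (mp_state M);
  rds_out : hom (cprod L T rds_state) (poly_pos p);
  rds_upd : hom (fib_sum rds_out) rds_state;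
  rds_action : forall s : section p, is_action (loop rds_upd s);
  rds_over : forall (s : section p) (I : E) (t : hom I T),
    rds_proj ∘ loop_at rds_upd s t =
    dyn_at (mp_dyn M) t ∘ cprod_map L (idm I) rds_proj
}.

Record rds_hom (X Y : open_rds) : Type := RDSHom {
  rds_map :> hom (rds_state X) (rds_state Y);
  rds_map_proj : rds_proj Y ∘ rds_map = rds_proj X;
  rds_map_comm : forall (I : E) (t : hom I T) (s : section p),
    rds_map ∘ (upd_at (rds_upd X) t ∘ sec_pull (out_at (rds_out X) t) s) =
    upd_at (rds_upd Y) t ∘ sec_pull (out_at (rds_out Y) t) s ∘
      cprod_map L (idm I) rds_map
}.

End Random.
End Open.
End Dynamics.

(* Main.v *)
From Stdlib Require Import ProofIrrelevance.
Require Import Defs.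

Set Implicit Arguments.
Unset Strict Implicit.
Local Open Scope cat_scope.

(** A morphism is a map of [E] subject to two equations, so the category structure can be lifted
    from [E]: both equations must hold for identities and survive composition, and the unit and
    associativity laws then descend from [E]. Since times are generalized elements at a stage [I],
    the dynamical equation compares [f] with [I * f]; closure therefore rests on functoriality of
    the product, [cprod_map_id] and [cprod_map_comp]. *)

Section ProductMaps.
Variables (E : category) (L : lcc E).

Lemma cprod_map_id (X Y : E) : cprod_map L (idm X) (idm Y) = idm (cprod L X Y).
Proof.
apply cprod_eq; unfold cprod_map.
- rewrite cpair_fst, comp_idl, comp_idr; reflexivity.
- rewrite cpair_snd, comp_idl, comp_idr; reflexivity.
Qed.

Lemma cprod_map_comp (X Y X' Y' X'' Y'' : E) (g : hom X' X'') (g' : hom Y' Y'')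
  (f : hom X X') (f' : hom Y Y') :
  cprod_map L g g' ∘ cprod_map L f f' = cprod_map L (g ∘ f) (g' ∘ f').
Proof.
apply cprod_eq; unfold cprod_map; rewrite comp_assoc.
- rewrite !cpair_fst, <- comp_assoc, cpair_fst; apply comp_assoc.
- rewrite !cpair_snd, <- comp_assoc, cpair_snd; apply comp_assoc.
Qed.

End ProductMaps.

Section RandomDynamicalSystems.
Variables (E : category) (L : lcc E) (P : monad E) (T : monoid L).
Variables (M : mpds T P) (p : polynomial E).

(** The other two fields are proofs, equal by proof irrelevance; this reduces each category law to
    the same law in [E]. *)
Lemma rds_hom_eq (X Y : open_rds p M) (f g : rds_hom X Y) :
  rds_map f = rds_map g -> f = g.
Proof.
destruct f as [f Hf Kf], g as [g Hg Kg]; simpl; intros ->.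
f_equal; apply proof_irrelevance.
Qed.

Definition rds_id (X : open_rds p M) : rds_hom X X.
Proof.
refine (@RDSHom E L T p P M X X (idm (rds_state X)) _ _).
- apply comp_idr.
- intros I t s; rewrite cprod_map_id, comp_idl, comp_idr; reflexivity.
Defined.

Definition rds_comp (X Y Z : open_rds p M) (g : rds_hom Y Z) (f : rds_hom X Y) :
  rds_hom X Z.
Proof.
refine (@RDSHom E L T p P M X Z (rds_map g ∘ rds_map f) _ _).
- rewrite comp_assoc, !rds_map_proj; reflexivity.
- intros I t s.
  (* Paste the two squares: [f] slides past the dynamics of [X], then [g] past that of [Y], leaving
     [I * g] after [I * f] to be merged. *)
  rewrite <- comp_assoc, rds_map_comm, comp_assoc, rds_map_comm.
  rewrite <- (comp_assoc _ (cprod_map L _ _) (cprod_map L _ _)).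
  rewrite cprod_map_comp, comp_idl; reflexivity.
Defined.

Definition rds_category : category_on (@rds_hom E L T p P M).
Proof.
refine (CategoryOn (id_of := rds_id) (comp_of := rds_comp) _ _ _);
  intros; apply rds_hom_eq; simpl.
- apply comp_idl.
- apply comp_idr.
- apply comp_assoc.
Defined.

End RandomDynamicalSystems.

Theorem proposition2p26 (E : category) (L : lcc E) (P : monad E) (T : monoid L)
    (M : mpds T P) (p : polynomial E) :
  exists RDyn : category_on (@rds_hom E L T p P M),
    (forall X : open_rds p M,
       rds_map (id_of RDyn X) = idm (rds_state X)) /\
    (forall (X Y Z : open_rds p M) (g : rds_hom Y Z) (f : rds_hom X Y),
       rds_map (comp_of RDyn g f) = rds_map g ∘ rds_map f).
Proof.
(* The structure is transparent, so both equations hold by computation. *)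
exists (rds_category M p); split; reflexivity.
Qed.
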